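(* Let $\lambda,\gamma\in[0,1]$. The observables $\mathsf{A}_\lambda$ and $\mathsf{B}_\gamma$ are jointly measurable if and only if $$\gamma\le\gamma_{\max}(\lambda)=\frac1d\left[(d-2)(1-\lambda)+2\sqrt{(1-d)\lambda^2+(d-2)\lambda+1}\right]$$ (or, equivalently, if and only if the inequality $\lambda\le\frac1d\left[(d-2)(1-\gamma)+2\sqrt{(1-d)\gamma^2+(d-2)\gamma+1}\right]$, obtained by exchanging $\gamma\leftrightarrow\lambda$, holds). If $\gamma=\gamma_{\max}(\lambda)$, then $\mathsf{A}_\lambda$ and $\mathsf{B}_\gamma$ have a unique joint observable. This unique joint observable is the covariant phase space observable $\mathsf{C}_T$ defined by the state $$T=|\chi_\lambda\rangle\langle\chi_\lambda|,\qquad \chi_\lambda=\alpha_\lambda\varphi_0+\beta_\lambda\psi_0,$$ with $$\alpha_\lambda=\frac{1}{\sqrt d}\left[\sqrt{(d-1)\lambda+1}-\sqrt{1-\lambda}\right],\qquad \beta_\lambda=\sqrt{1-\lambda}.$$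
   Context: Let $\mathcal{H}$ be a complex Hilbert space with $\dim\mathcal{H}=d\ge 2$ (inner product linear in the second argument), and $\mathcal{S(H)}$ the set of states (positive operators of trace one). $\mathbb{Z}_d=\{0,\dots,d-1\}$ with arithmetic modulo $d$, and $\omega=e^{2\pi i/d}$. An observable with finite outcome set $\Omega$ is a map $x\mapsto\mathsf{E}(x)$ from $\Omega$ to positive operators on $\mathcal{H}$ with $\sum_{x\in\Omega}\mathsf{E}(x)=\mathbb{1}$. Fix an orthonormal basis $\{\varphi_j\}_{j\in\mathbb{Z}_d}$ of $\mathcal{H}$ and set $\psi_k=\frac{1}{\sqrt d}\sum_{h\in\mathbb{Z}_d}\omega^{hk}\varphi_h$ for $k\in\mathbb{Z}_d$; $\{\psi_k\}$ is an orthonormal basis. Put $\mathsf{A}(j)=|\varphi_j\rangle\langle\varphi_j|$, $\mathsf{B}(k)=|\psi_k\rangle\langle\psi_k|$, and for $\lambda,\gamma\in[0,1]$ define observables on $\mathbb{Z}_d$ by $\mathsf{A}_\lambda(j)=\lambda\mathsf{A}(j)+(1-\lambda)\frac1d\mathbb{1}$ and $\mathsf{B}_\gamma(k)=\gamma\mathsf{B}(k)+(1-\gamma)\frac1d\mathbb{1}$. A joint observable of two observables $\mathsf{E},\mathsf{F}$ on $\mathbb{Z}_d$ is an observable $\mathsf{C}$ on $\mathbb{Z}_d\times\mathbb{Z}_d$ with $\sum_{k}\mathsf{C}(j,k)=\mathsf{E}(j)$ for all $j$ and $\sum_{j}\mathsf{C}(j,k)=\mathsf{F}(k)$ for all $k$;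 $\mathsf{E}$ and $\mathsf{F}$ are jointly measurable if a joint observable exists. For $\lambda\in[0,1]$, $\gamma_{\max}(\lambda)$ denotes the largest $\gamma\in[0,1]$ such that $\mathsf{A}_\lambda$ and $\mathsf{B}_\gamma$ are jointly measurable. Let $U_x\varphi_k=\varphi_{k+x}$ and $V_y\varphi_k=\omega^{yk}\varphi_k$ for $x,y,k\in\mathbb{Z}_d$. For $T\in\mathcal{S(H)}$, the covariant phase space observable $\mathsf{C}_T$ on $\mathbb{Z}_d\times\mathbb{Z}_d$ is $\mathsf{C}_T(j,k)=\frac1d U_jV_kTV_k^*U_j^*$. *)

(* Defs.v *)
From HB Require Import structures.
From mathcomp Require Import all_boot all_order all_algebra.
From mathcomp Require Import all_classical reals trigo.
From mathcomp Require Import complex.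

Set Implicit Arguments.
Unset Strict Implicit.
Unset Printing Implicit Defensive.

Import Order.TTheory GRing.Theory Num.Theory.
Local Open Scope ring_scope.
Local Open Scope complex_scope.

(* A finite-dimensional complex Hilbert space is a [H : vectType R[i]] together
   with a positive definite Hermitian form [dot : {dot H for Num.conj}]; its
   (bounded) operators are the elements of ['End(H)]. *)

(* The library's forms are linear in the first argument. *)
Definition braket (R : realType) (H : vectType R[i])
    (dot : {dot H for Num.conj}) (u v : H) : R[i] := dot v u.

Definition ketbra (R : realType) (H : vectType R[i])
    (dot : {dot H for Num.conj}) (u v : H) : 'End(H) :=
  linfun (fun w => braket dot v w *: u).

Definition orthonormal_basis (R : realType) (H : vectType R[i])
    (dot : {dot H for Num.conj}) (I : finType) (e : I -> H) : Prop :=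
  orthonormal dot (codom e) /\ basis_of fullv (codom e).

(* The order of [R[i]] is the partial one: [0 <= z] says that [z] is real and
   nonnegative. *)
Definition positive_op (R : realType) (H : vectType R[i])
    (dot : {dot H for Num.conj}) (E : 'End(H)) : Prop :=
  forall u : H, 0 <= braket dot u (E u).

(* The default [0] is never used, since adjoints exist and are unique in finite
   dimension. *)
Definition adjoint_op (R : realType) (H : vectType R[i])
    (dot : {dot H for Num.conj}) (E : 'End(H)) : 'End(H) :=
  xget 0 [set F : 'End(H) |
          forall u v : H, braket dot (F u) v = braket dot u (E v)]%classic.

(* [vbasis fullv] is some basis of [H]; the trace does not depend on it. *)
Definition trace_op (R : realType) (H : vectType R[i]) (E : 'End(H)) : R[i] :=
  \tr (passmx.mxof (vbasis fullv) (vbasis fullv) E).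

Definition is_state (R : realType) (H : vectType R[i])
    (dot : {dot H for Num.conj}) (T : 'End(H)) : Prop :=
  positive_op dot T /\ trace_op T = 1.

Definition observable (R : realType) (H : vectType R[i])
    (dot : {dot H for Num.conj}) (Omega : finType) (E : Omega -> 'End(H)) : Prop :=
  (forall x, positive_op dot (E x)) /\ \sum_x E x = \1%VF.

Definition joint_observable (R : realType) (H : vectType R[i])
    (dot : {dot H for Num.conj}) (Omega1 Omega2 : finType)
    (E : Omega1 -> 'End(H)) (F : Omega2 -> 'End(H))
    (C : Omega1 * Omega2 -> 'End(H)) : Prop :=
  [/\ observable dot C,
      forall j, \sum_k C (j, k) = E j
    & forall k, \sum_j C (j, k) = F k].

Definition jointly_measurable (R : realType) (H : vectType R[i])
    (dot : {dot H for Num.conj}) (Omega1 Omega2 : finType)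
    (E : Omega1 -> 'End(H)) (F : Omega2 -> 'End(H)) : Prop :=
  exists C : Omega1 * Omega2 -> 'End(H), joint_observable dot E F C.

(* In what follows ['Z_d] is the ring of integers modulo [d] only for [1 < d]. *)

Definition omega (R : realType) (d : nat) : R[i] :=
  cos (2 * pi / d%:R) +i* sin (2 * pi / d%:R).

Definition psi (R : realType) (H : vectType R[i]) (d : nat)
    (phi : 'Z_d -> H) (k : 'Z_d) : H :=
  (1 / Num.sqrt d%:R)%:C *: \sum_(h : 'Z_d) omega R d ^+ (h * k)%N *: phi h.

Definition obsA (R : realType) (H : vectType R[i]) (dot : {dot H for Num.conj})
    (d : nat) (phi : 'Z_d -> H) (lambda : R) (j : 'Z_d) : 'End(H) :=
  lambda%:C *: ketbra dot (phi j) (phi j) +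
  ((1 - lambda) * (1 / d%:R))%:C *: \1%VF.

Definition obsB (R : realType) (H : vectType R[i]) (dot : {dot H for Num.conj})
    (d : nat) (phi : 'Z_d -> H) (gamma : R) (k : 'Z_d) : 'End(H) :=
  gamma%:C *: ketbra dot (psi phi k) (psi phi k) +
  ((1 - gamma) * (1 / d%:R))%:C *: \1%VF.

Definition jmAB (R : realType) (H : vectType R[i]) (dot : {dot H for Num.conj})
    (d : nat) (phi : 'Z_d -> H) (lambda gamma : R) : Prop :=
  jointly_measurable dot (obsA dot phi lambda) (obsB dot phi gamma).

Definition is_gamma_max (R : realType) (H : vectType R[i])
    (dot : {dot H for Num.conj}) (d : nat) (phi : 'Z_d -> H) (lambda g : R) :
    Prop :=
  [/\ 0 <= g <= 1,
      jmAB dot phi lambda g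
    & forall g', 0 <= g' <= 1 -> jmAB dot phi lambda g' -> g' <= g].

(* The linear extension of [phi k |-> phi (k + x)]. *)
Definition shiftU (R : realType) (H : vectType R[i]) (dot : {dot H for Num.conj})
    (d : nat) (phi : 'Z_d -> H) (x : 'Z_d) : 'End(H) :=
  \sum_(k : 'Z_d) ketbra dot (phi (k + x)) (phi k).

(* The linear extension of [phi k |-> omega ^+ (y * k) *: phi k]. *)
Definition clockV (R : realType) (H : vectType R[i]) (dot : {dot H for Num.conj})
    (d : nat) (phi : 'Z_d -> H) (y : 'Z_d) : 'End(H) :=
  \sum_(k : 'Z_d) omega R d ^+ (y * k)%N *: ketbra dot (phi k) (phi k).

Definition phase_space_obs (R : realType) (H : vectType R[i])
    (dot : {dot H for Num.conj}) (d : nat) (phi : 'Z_d -> H) (T : 'End(H))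
    (jk : 'Z_d * 'Z_d) : 'End(H) :=
  let U := shiftU dot phi jk.1 in
  let V := clockV dot phi jk.2 in
  (1 / d%:R) *: (U \o V \o T \o adjoint_op dot V \o adjoint_op dot U)%VF.

Definition gamma_bound (R : realType) (d : nat) (lambda : R) : R :=
  1 / d%:R * ((d%:R - 2) * (1 - lambda) +
    2 * Num.sqrt ((1 - d%:R) * lambda ^+ 2 + (d%:R - 2) * lambda + 1)).

Definition alpha (R : realType) (d : nat) (lambda : R) : R :=
  1 / Num.sqrt d%:R *
    (Num.sqrt ((d%:R - 1) * lambda + 1) - Num.sqrt (1 - lambda)).

Definition beta (R : realType) (lambda : R) : R := Num.sqrt (1 - lambda).

Definition chi (R : realType) (H : vectType R[i]) (d : nat)
    (phi : 'Z_d -> H) (lambda : R) : H :=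
  (alpha d lambda)%:C *: phi 0 + (beta lambda)%:C *: psi phi 0.

(* Main.v *)
(* Put s = 1/sqrt d, let W_jk = U_j V_k and let x = a phi_0 + b psi_0 be a unit
   vector with a, b >= 0. The operator
     (a + b s)(a s + b) - a (a s + b) |phi_j><phi_j| - b (a + b s) |psi_k><psi_k|
   is nonnegative with kernel spanned by W_jk x. Pairing it with C(j,k) under the
   trace and summing over (j,k) turns joint measurability into a linear inequality
   between lambda and gamma. For a = alpha, b = beta the inequality is
   gamma <= gamma_max(lambda); in the equality case every C(j,k) is a multiple
   c_jk of |W_jk x><W_jk x|. The marginals then determine the discrete Fourier
   transform of c_j, so that c_jk = 1/d. For lambda = 1, where b = 0 makes the
   inequality void, equality always holds and the rank-one form gives gamma = 0.
   Conversely C_T attains gamma_max, and smaller gamma follow by mixing with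
   A_lambda(j)/d. *)
Require Import Defs.
From HB Require Import structures.
From mathcomp Require Import all_boot all_order all_algebra.
From mathcomp Require Import all_classical reals trigo.
From mathcomp Require Import complex.
From mathcomp Require Import ring lra.

Set Implicit Arguments.
Unset Strict Implicit.
Unset Printing Implicit Defensive.

Import Order.TTheory GRing.Theory Num.Theory.
Local Open Scope ring_scope.
Local Open Scope complex_scope.

(** * Positive operators and trace inequalities *)

Section Operators.
Context (R : realType) (H : vectType R[i]) (dot : {dot H for Num.conj}).
Local Notation br := (braket dot).
Implicit Types (u v w : H) (a b : R[i]) (E F : 'End(H)).

Lemma braketC u v : br u v = Num.conj (br v u).
Proof. by rewrite /braket hermC expr0 mul1r. Qed.

Lemma braketDl u1 u2 v : br (u1 + u2) v = br u1 v + br u2 v.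
Proof. by rewrite /braket linearDr. Qed.

Lemma braketBl u1 u2 v : br (u1 - u2) v = br u1 v - br u2 v.
Proof. by rewrite /braket linearBr. Qed.

Lemma braketZl a u v : br (a *: u) v = Num.conj a * br u v.
Proof. by rewrite /braket linearZr. Qed.

Lemma braket_suml (I : finType) (f : I -> H) v :
  br (\sum_i f i) v = \sum_i br (f i) v.
Proof. by rewrite /braket linear_sumr. Qed.

Lemma braket0r u : br u 0 = 0.
Proof. by rewrite /braket linear0l. Qed.

Lemma braketDr u v1 v2 : br u (v1 + v2) = br u v1 + br u v2.
Proof. by rewrite /braket linearDl. Qed.

Lemma braketBr u v1 v2 : br u (v1 - v2) = br u v1 - br u v2.
Proof. by rewrite /braket linearBl. Qed.

Lemma braketZr a u v : br u (a *: v) = a * br u v.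
Proof. by rewrite /braket linearZl_LR. Qed.

Lemma braket_sumr (I : finType) u (f : I -> H) :
  br u (\sum_i f i) = \sum_i br u (f i).
Proof. by rewrite /braket linear_sumlz. Qed.

Lemma braket_ge0 u : 0 <= br u u.
Proof. exact: dnorm_ge0. Qed.

Lemma braket_eq0 u : br u u = 0 -> u = 0.
Proof. by move/eqP; rewrite /braket dnorm_eq0 => /eqP. Qed.

Lemma braket_inj u v : (forall w, br w u = br w v) -> u = v.
Proof.
move=> uv; apply/eqP; rewrite -subr_eq0; apply/eqP/braket_eq0.
by rewrite braketBr uv subrr.
Qed.

Lemma lfunD E u v : E (u + v) = E u + E v.
Proof. exact: linearD. Qed.

Lemma lfunB E u v : E (u - v) = E u - E v.
Proof. exact: linearB. Qed.

Lemma lfunZ E a u : E (a *: u) = a *: E u.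
Proof. exact: linearZ. Qed.

Lemma lfun_sum E (I : finType) (f : I -> H) : E (\sum_i f i) = \sum_i E (f i).
Proof. exact: linear_sum. Qed.

Lemma ketbraE u v w : ketbra dot u v w = br v w *: u.
Proof.
have lin : linear (fun w => br v w *: u).
  by move=> a x y; rewrite braketDr braketZr scalerDl scalerA.
(* [ketbra] applies [linfun] to a bare function, whereas [lfunE] evaluates a bundled linear map. *)
pose L := GRing.isLinear.Build R[i] H H *:%R (fun w => br v w *: u) lin.
pose f : {linear H -> H} := HB.pack (fun w => br v w *: u) L.
exact: (lfunE f).
Qed.

(** Polarisation: the quadratic form of E is real at u + v and at u + i v. With x = <u|E v> and y =
    <v|E u> this makes x + y and i (x - y) real, so x is the conjugate of y. *)
Lemma positive_opC E u v :
  positive_op dot E -> br u (E v) = Num.conj (br v (E u)).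
Proof.
move=> E0; have q_real w : Num.conj (br w (E w)) = br w (E w).
  exact/CrealP/ger0_real/E0.
have := q_real (u + v); have := q_real (u + 'i%R *: v).
rewrite !lfunD !lfunZ /= !braketDl !braketDr !braketZl !braketZr.
rewrite !rmorphD !rmorphM /= !q_real conjCK conjCi.
set x := br u (E v); set y := br v (E u); set x' := Num.conj x; set y' := Num.conj y.
move=> e1 e2.
have i2 : 'i%R * 'i%R = -1 :> R[i] by rewrite -expr2 sqrCi.
have e3 : x + y = x' + y'.
  have : x + y = (br u (E u) + x + (y + br v (E v))) - br u (E u) - br v (E v) by ring.
  by rewrite -e2 => ->; ring.
have e4 : 'i%R * (x - y) = 'i%R * (y' - x').
  have -> : 'i%R * (x - y) = (br u (E u) + 'i%R * x
     + (- 'i%R * y + - 'i%R * ('i%R * br v (E v))))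
     - br u (E u) - br v (E v) + ('i%R * 'i%R + 1) * br v (E v) by ring.
  rewrite -e1 i2 ?rmorphN /= ?conjCi; ring: i2.
have {}e4 : x - y = y' - x' by apply: (mulfI (neq0Ci _)).
have : 2 * x = 2 * y'.
  have -> : 2 * x = (x + y) + (x - y) by ring.
  by rewrite e3 e4; ring.
by apply: mulfI; rewrite pnatr_eq0.
Qed.

Lemma positive_op_ker E v : positive_op dot E -> br v (E v) = 0 -> E v = 0.
Proof.
move=> E0 Ev0; set u := E v.
have c0 : 0 <= br u (E u) by apply: E0.
have n0 : 0 <= br u u by apply: braket_ge0.
set c := br u (E u) in c0; set n := br u u in n0.
have cR : Num.conj c = c by exact/CrealP/ger0_real.
have nR : Num.conj n = n by exact/CrealP/ger0_real.
have vEu : br v (E u) = n by rewrite positive_opC // -/u -/n nR.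
(* At t v - n u the form equals n^2 (c - 2 t). The choice t = c + 1 turns this into -(c + 2) n^2,
   which forces n = 0 even when c = 0. *)
have := E0 ((c + 1) *: v - n *: u).
rewrite !lfunB !lfunZ /= !braketBl !braketBr !braketZl !braketZr -/u -/n -/c.
rewrite rmorphD rmorph1 /= cR nR vEu Ev0 -/u -/n.
have -> : (c + 1) * ((c + 1) * 0) - (c + 1) * (n * n) -
   (n * ((c + 1) * n) - n * (n * c)) = - ((c + 2) * n ^+ 2) by ring.
rewrite oppr_ge0 pmulr_rle0 ?ltr_wpDl // => n2.
apply: braket_eq0; rewrite -/u -/n; apply/eqP.
by rewrite -sqrf_eq0 eq_le n2 exprn_ge0.
Qed.

Section Basis.
Context (I : finType) (e : I -> H).
Hypothesis e_basis : orthonormal_basis dot e.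

Lemma orthonormal_basis_inj : injective e.
Proof.
by apply/injectiveP; have [_ /basis_free/free_uniq] := e_basis.
Qed.

Lemma orthonormal_basisE i j : br (e i) (e j) = (i == j)%:R.
Proof.
have [/orthonormalP [_ eE] _] := e_basis.
by rewrite /braket eE ?codom_f // (inj_eq orthonormal_basis_inj) eq_sym.
Qed.

Lemma orthonormal_basis_sum v : v = \sum_i br (e i) v *: e i.
Proof.
have [_ bas] := e_basis.
have : v \in <<codom e>>%VS by rewrite (span_basis bas) memvf.
rewrite /codom /image_mem span_def big_map big_enum => /memv_sumP[w wP ->].
apply: eq_bigr => i _; rewrite braket_sumr (bigD1 i) //= big1.
  have /vlineP[k ->] := wP i isT.
  by rewrite braketZr orthonormal_basisE eqxx mulr1 addr0.
move=> j ji; have /vlineP[k ->] := wP j isT.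
by rewrite braketZr orthonormal_basisE eq_sym (negPf ji) mulr0.
Qed.

Lemma parseval u v : \sum_i br u (e i) * br (e i) v = br u v.
Proof.
rewrite [in RHS](orthonormal_basis_sum v) braket_sumr.
by apply: eq_bigr => i _; rewrite braketZr mulrC.
Qed.

Lemma lfun_basis_sum E v : E v = \sum_i br (e i) v *: E (e i).
Proof.
rewrite [in LHS](orthonormal_basis_sum v) lfun_sum.
by apply: eq_bigr => i _; rewrite lfunZ.
Qed.

Lemma orthonormal_basis_ext u v : (forall i, br (e i) u = br (e i) v) -> u = v.
Proof.
move=> uv; rewrite (orthonormal_basis_sum u) (orthonormal_basis_sum v).
by apply: eq_bigr => i _; rewrite uv.
Qed.

Lemma op_basis_ext E F :
  (forall i j, br (e i) (E (e j)) = br (e i) (F (e j))) -> E = F.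
Proof.
move=> EF; apply/lfunP => v; rewrite (lfun_basis_sum E) (lfun_basis_sum F).
apply: eq_bigr => j _; congr (_ *: _).
by apply: orthonormal_basis_ext => i; rewrite EF.
Qed.

Definition basis_trace E := \sum_i br (e i) (E (e i)).
Local Notation tr := basis_trace.

(** For nonzero u let Q be the projection onto its orthocomplement. The vectors on the left are
    <u|u> Q e_i, so both sides are <u|u>^2 tr (Q E Q). The scaling by <u|u> avoids a division. *)
Lemma basis_trace_compress E u :
  \sum_i br (br u u *: e i - br u (e i) *: u) (E (br u u *: e i - br u (e i) *: u))
  = br u u * (br u u * tr E - br u (E u)).
Proof.
set n := br u u.
have nR : Num.conj n = n by exact/CrealP/ger0_real/braket_ge0.
transitivity (\sum_i (n ^+ 2 * br (e i) (E (e i)) - n * (br u (e i) * br (e i) (E u))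
   - n * (br (e i) u * br u (E (e i))) + (br u (e i) * br (e i) u) * br u (E u))).
  apply: eq_bigr => i _.
  rewrite !lfunB !lfunZ /= !braketBl !braketBr !braketZl !braketZr nR -braketC.
  ring.
rewrite !big_split /= !sumrN -!mulr_sumr -mulr_suml !parseval -/n.
have -> : \sum_i br (e i) u * br u (E (e i)) = br u (E u).
  rewrite [in RHS]lfun_basis_sum braket_sumr.
  by apply: eq_bigr => i _; rewrite braketZr.
rewrite -/(basis_trace E); ring.
Qed.

Lemma ler_basis_trace E u :
  positive_op dot E -> br u (E u) <= br u u * tr E.
Proof.
move=> E0; have [->|u0] := eqVneq u 0.
  by rewrite linear0 !braket0r mul0r.
rewrite -subr_ge0 -(@pmulr_rge0 _ (br u u)) /braket ?dnorm_gt0 // -/(br u u).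
rewrite -/(br u (E u)) -basis_trace_compress; apply: sumr_ge0 => i _; exact: E0.
Qed.

(** Equality case of [ler_basis_trace]: the nonnegative terms of [basis_trace_compress] all vanish,
    so E kills every e_i - <u|e_i> u. Thus E w = <u|w> E u, and the symmetry of E makes E u a
    multiple of u. *)
Lemma basis_trace_rank1 E u :
  positive_op dot E -> br u u = 1 -> tr E = br u (E u) ->
  E = tr E *: ketbra dot u u.
Proof.
move=> E0 u1 trE.
have := basis_trace_compress E u; rewrite u1 -trE !mul1r subrr.
move/eqP; rewrite psumr_eq0 => [/allP /= z|i _]; last exact: E0.
have Ee i : E (e i) = br u (e i) *: E u.
  have /eqP/(positive_op_ker E0) := z i (mem_index_enum i).
  by rewrite lfunB !lfunZ scale1r => /eqP; rewrite subr_eq0 => /eqP.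
have Ew w : E w = br u w *: E u.
  rewrite lfun_basis_sum; under eq_bigr do rewrite Ee scalerA mulrC.
  by rewrite -scaler_suml parseval.
have Eu : E u = tr E *: u.
  apply: braket_inj => w; rewrite positive_opC // Ew !braketZr trE rmorphM /=.
  by rewrite -braketC -positive_opC // mulrC.
by apply/lfunP => w; rewrite scale_lfunE ketbraE Ew Eu !scalerA mulrC.
Qed.

Lemma ketbra_compress_positive E u :
  positive_op dot E ->
  let P := (\1 - ketbra dot u u)%VF in positive_op dot (P \o E \o P)%VF.
Proof.
move=> E0 P w.
have PE x : P x = x - br u x *: u.
  by rewrite /P add_lfunE opp_lfunE id_lfunE ketbraE.
rewrite !comp_lfunE.
suff -> x : br w (P x) = br (P w) x by apply: E0.
by rewrite !PE braketBl braketBr braketZl braketZr -braketC mulrC.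
Qed.

(* The operator inequality behind this bound is [(1 - s ^+ 2) P >= 0], where [P]
   is the projection onto the orthocomplement of [u] and [v]. *)
Lemma ler_basis_trace2 E u v (s : R[i]) :
  positive_op dot E -> br u u = 1 -> br v v = 1 -> 0 <= s -> br u v = s ->
  br v (E v) - s * br u (E v) - s * br v (E u) + s ^+ 2 * br u (E u)
  <= (1 - s ^+ 2) * (tr E - br u (E u)).
Proof.
move=> E0 u1 v1 s0 uv; have sR : Num.conj s = s by exact/CrealP/ger0_real.
have vu : br v u = s by rewrite braketC uv sR.
(* The trace bound is applied to P E P with P = 1 - |u><u|, at the component v - s u of v orthogonal
   to u, whose squared norm is 1 - s^2. *)
have := ler_basis_trace (v - s *: u) (ketbra_compress_positive u E0).
set P := (\1 - _)%VF.
have PE x : P x = x - br u x *: u.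
  by rewrite /P add_lfunE opp_lfunE id_lfunE ketbraE.
have PC x y : br x (P y) = br (P x) y.
  by rewrite !PE braketBl braketBr braketZl braketZr -braketC mulrC.
have -> : tr (P \o E \o P)%VF = tr E - br u (E u).
  have := basis_trace_compress E u; rewrite u1 !mul1r => <-.
  by apply: eq_bigr => i _; rewrite !comp_lfunE PC !PE !scale1r.
have Pvu : P (v - s *: u) = v - s *: u.
  by rewrite PE braketBr braketZr uv u1 mulr1 subrr scale0r subr0.
rewrite !comp_lfunE PC Pvu lfunB lfunZ !braketBl !braketBr !braketZl !braketZr.
rewrite sR uv vu u1 v1.
by congr (_ <= _); ring.
Qed.

(* The operator [mu - a (a s + b) |u><u| - b (a + b s) |v><v|] with
   [mu = (a + b s) (a s + b)] is [s (<x|x> - |x><x|)] plus a nonnegative multiple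
   of the projection onto the orthocomplement of [u] and [v]. *)
Lemma ler_basis_trace_superposition E u v (s a b : R[i]) :
  positive_op dot E -> br u u = 1 -> br v v = 1 -> br u v = s ->
  0 <= s -> 0 <= a -> 0 <= b ->
  let x := a *: u + b *: v in
  s * (br x x * tr E - br x (E x)) <=
  (a + b * s) * (a * s + b) * tr E - a * (a * s + b) * br u (E u)
  - b * (a + b * s) * br v (E v).
Proof.
move=> E0 u1 v1 uv s0 a0 b0 /=.
have aR : Num.conj a = a by exact/CrealP/ger0_real.
have bR : Num.conj b = b by exact/CrealP/ger0_real.
have sR : Num.conj s = s by exact/CrealP/ger0_real.
have vu : br v u = s by rewrite braketC uv sR.
have := ler_basis_trace2 E0 u1 v1 s0 uv; rewrite -subr_ge0 => le2.
rewrite !lfunD !lfunZ !braketDl !braketDr !braketZl !braketZr aR bR.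
rewrite uv vu u1 v1 -subr_ge0.
(* The gap between the two sides is exactly a b times the gap in [ler_basis_trace2]. *)
apply: le_trans (mulr_ge0 (mulr_ge0 a0 b0) le2) _.
by rewrite le_eqVlt; apply/orP; left; apply/eqP; ring.
Qed.

End Basis.
End Operators.

(** * Adjoints, rank-one operators and their trace *)

Section Adjoint.
Context (R : realType) (H : vectType R[i]) (dot : {dot H for Num.conj}).
Local Notation br := (braket dot).
Implicit Types (u v w : H) (E F : 'End(H)).

Lemma adjoint_opP (I : finType) (e : I -> H) E u v :
  orthonormal_basis dot e -> br (adjoint_op dot E u) v = br u (E v).
Proof.
move=> e_basis; move: u v; apply: (@xgetPex _ 0
  [set F : 'End(H) | forall u v, br (F u) v = br u (E v)]%classic).
(* The adjoint written out in the basis; its existence rules out the default value of [xget]. *)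
exists (\sum_i ketbra dot (e i) (E (e i))) => u v /=.
rewrite sum_lfunE braket_suml (lfun_basis_sum e_basis) braket_sumr.
by apply: eq_bigr => i _; rewrite ketbraE braketZl braketZr -braketC mulrC.
Qed.

Lemma comp_ketbra E u v : (E \o ketbra dot u v)%VF = ketbra dot (E u) v.
Proof. by apply/lfunP => w; rewrite comp_lfunE !ketbraE lfunZ. Qed.

Lemma ketbra_comp_adjoint (I : finType) (e : I -> H) E u v :
  orthonormal_basis dot e ->
  (ketbra dot u v \o adjoint_op dot E)%VF = ketbra dot u (E v).
Proof.
move=> e_basis; apply/lfunP => w; rewrite comp_lfunE !ketbraE.
by rewrite (braketC _ v) (adjoint_opP _ _ _ e_basis) -braketC.
Qed.

Lemma trace_op_ketbra u v : trace_op (ketbra dot u v) = br v u.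
Proof.
rewrite /trace_op /mxtrace.
rewrite [in RHS](coord_vbasis (memvf u)) braket_sumr; apply: eq_bigr => i _.
rewrite mxE /= -passmx.coord_rVof.
rewrite -(passmx.rVofE (vbasisP _)) passmx.rVofK ?vbasisP //.
by rewrite ketbraE linearZ /= braketZr mulrC.
Qed.

Lemma braket_noisy_ketbra (p q : R) u v w :
  br v ((p%:C *: ketbra dot u u + q%:C *: \1)%VF w)
  = p%:C * (br v u * br u w) + q%:C * br v w.
Proof.
rewrite add_lfunE !scale_lfunE ketbraE id_lfunE braketDr !braketZr.
by rewrite (mulrC (br u w)).
Qed.

Lemma ketbra_positive u : positive_op dot (ketbra dot u u).
Proof. by move=> v; rewrite ketbraE braketZr (braketC _ v) mul_conjC_ge0. Qed.

End Adjoint.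

(** * Additive characters of the integers modulo d *)

Section RootsOfUnity.
Context (R : realType) (d : nat).
Hypothesis hd : (1 < d)%N.
Local Notation w := (omega R d).

Lemma omegaX m :
  w ^+ m = cos (2 * pi * m%:R / d%:R) +i* sin (2 * pi * m%:R / d%:R).
Proof.
elim: m => [|m IH]; first by rewrite mulr0 mul0r cos0 sin0.
rewrite exprS IH /omega.
have -> : 2 * pi * m.+1%:R / d%:R = 2 * pi / d%:R + 2 * pi * m%:R / d%:R :> R.
  by rewrite -natr1; ring.
rewrite cosD sinD; apply/eqP; rewrite eq_complex /=.
by apply/andP; split; apply/eqP; ring.
Qed.

Lemma omega_exprd : w ^+ d = 1.
Proof.
rewrite omegaX mulfK ?pnatr_eq0 -?lt0n ?(ltnW hd) //.
by rewrite mulr_natl cos2pi sin2pi.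
Qed.

(** Half angle: for t = pi m / d, cos (2 t) = 1 would force sin t = 0, but 0 < t < pi. *)
Lemma omega_expr_neq1 m : (0 < m < d)%N -> w ^+ m != 1.
Proof.
move=> /andP[m0 md]; rewrite omegaX; apply/eqP => -[c1 _]; move: c1.
have -> : 2 * pi * m%:R / d%:R = (pi * m%:R / d%:R) *+ 2 :> R.
  by rewrite -mulr_natl; ring.
have d0 : 0 < d%:R :> R by rewrite ltr0n (ltnW hd).
have : 0 < sin (pi * m%:R / d%:R : R).
  apply: sin_gt0_pi; rewrite ?divr_gt0 ?mulr_gt0 ?pi_gt0 ?ltr0n ?(ltnW hd) //.
  by rewrite ltr_pdivrMr // ltr_pM2l ?pi_gt0 // ltr_nat.
rewrite cos_mulr2n => s0 /eqP.
have := cos2Dsin2 (pi * m%:R / d%:R : R) => e.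
nra.
Qed.

Lemma omega_norm1 : w * Num.conj w = 1.
Proof.
rewrite /omega; apply/eqP; rewrite eq_complex /=.
have := cos2Dsin2 (2 * pi / d%:R : R) => e.
by apply/andP; split; apply/eqP; [rewrite -[RHS]e|]; ring.
Qed.

(** Arithmetic in ['Z_d] reduces modulo [(Zp_trunc d).+2], which is d because 1 < d. *)
Lemma omega_expr_mod m : w ^+ (m %% (Zp_trunc d).+2) = w ^+ m.
Proof. by rewrite Zp_cast // expr_mod // omega_exprd. Qed.

Definition Zp_char (x : 'Z_d) : R[i] := w ^+ x.
Local Notation e := Zp_char.

Lemma Zp_charM_nat (x y : 'Z_d) : w ^+ (x * y)%N = e (x * y).
Proof. by rewrite /e /= omega_expr_mod. Qed.

Lemma Zp_charD x y : e (x + y) = e x * e y.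
Proof. by rewrite /e /= omega_expr_mod exprD. Qed.

Lemma Zp_char0 : e 0 = 1.
Proof. by []. Qed.

Lemma Zp_char_neq0 x : e x != 0.
Proof.
apply/eqP => ex; have := Zp_charD x (- x).
by rewrite subrr ex mul0r => /eqP; rewrite oner_eq0.
Qed.

Lemma Zp_charN x : e (- x) = Num.conj (e x).
Proof.
apply: (mulfI (Zp_char_neq0 x)).
by rewrite -Zp_charD subrr /e rmorphXn -exprMn omega_norm1 expr1n.
Qed.

(** Orthogonality of characters: for nonzero x the sum is geometric with ratio e(x) different from 1
    and e(x)^d = 1. *)
Lemma Zp_char_sum x : \sum_(k : 'Z_d) e (x * k) = d%:R * (x == 0)%:R.
Proof.
have [->|x0] := eqVneq x 0.
  under eq_bigr do rewrite mul0r Zp_char0.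
  by rewrite sumr_const card_ord Zp_cast // mulr1.
rewrite mulr0; apply/eqP.
have x1 : e x - 1 != 0.
  have := ltn_ord x; rewrite [ltnRHS]Zp_cast // => xd.
  by rewrite subr_eq0 omega_expr_neq1 // xd andbT lt0n.
rewrite -(mulrI_eq0 _ (mulfI x1)).
under eq_bigr do rewrite -Zp_charM_nat exprM.
rewrite -subrX1 /e -exprM mulnC exprM.
have -> : w ^+ (Zp_trunc d).+2 = 1 by rewrite Zp_cast // omega_exprd.
by rewrite expr1n subrr.
Qed.

End RootsOfUnity.

(** The common modulus of the inner products between the two mutually unbiased bases. *)
Definition overlap (R : realType) (d : nat) : R[i] := (1 / Num.sqrt d%:R)%:C.

(** * Weyl operators and matrix elements of the observables *)

Section Weyl.
Context (R : realType) (H : vectType R[i]) (dot : {dot H for Num.conj}).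
Context (d : nat) (phi : 'Z_d -> H).
Hypothesis hd : (1 < d)%N.
Hypothesis hphi : orthonormal_basis dot phi.
Local Notation br := (braket dot).
Local Notation e := (@Zp_char R d).
Local Notation s := (overlap R d).
Local Notation tr := (basis_trace dot phi).

Lemma braket_phi m n : br (phi m) (phi n) = (m == n)%:R.
Proof. exact: orthonormal_basisE. Qed.

Lemma sqrtd_gt0 : 0 < Num.sqrt d%:R :> R.
Proof. by rewrite sqrtr_gt0 ltr0n (ltnW hd). Qed.

Lemma natrC_neq0 : d%:R != 0 :> R[i].
Proof. by rewrite pnatr_eq0 -lt0n (ltnW hd). Qed.

Lemma overlap_gt0 : 0 < s :> R[i].
Proof. by rewrite /overlap ltcR divr_gt0 ?sqrtd_gt0. Qed.

Lemma conj_overlap : Num.conj s = s :> R[i].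
Proof. exact/CrealP/ger0_real/ltW/overlap_gt0. Qed.

Lemma overlap_sqr : s * s = d%:R^-1 :> R[i].
Proof.
rewrite /overlap -rmorphM /= mulf_div mulr1 -expr2 sqr_sqrtr ?ler0n // div1r.
by rewrite fmorphV rmorph_nat.
Qed.

Lemma braket_phi_psi m k : br (phi m) (psi phi k) = s * e (m * k).
Proof.
rewrite /psi braketZr braket_sumr (bigD1 m) //= big1 ?addr0.
  by rewrite braketZr braket_phi eqxx mulr1 Zp_charM_nat.
by move=> h hm; rewrite braketZr braket_phi eq_sym (negPf hm) mulr0.
Qed.

Lemma braket_psi_phi m k : br (psi phi k) (phi m) = s * e (- (m * k)).
Proof. by rewrite braketC braket_phi_psi rmorphM /= conj_overlap Zp_charN. Qed.

Lemma sum_overlap_sqr : \sum_(k : 'Z_d) s * s = 1 :> R[i].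
Proof.
rewrite sumr_const card_ord Zp_cast // -[LHS]mulr_natl overlap_sqr.
by rewrite mulfV // natrC_neq0.
Qed.

Lemma psi_unit k : br (psi phi k) (psi phi k) = 1.
Proof.
rewrite -(parseval hphi) -[RHS]sum_overlap_sqr; apply: eq_bigr => m _.
rewrite braket_phi_psi braket_psi_phi mulrACA -Zp_charD //.
by rewrite addNr Zp_char0 mulr1.
Qed.

Definition weyl (jk : 'Z_d * 'Z_d) : 'End(H) :=
  (shiftU dot phi jk.1 \o clockV dot phi jk.2)%VF.

Lemma braket_phi_weyl m jk v :
  br (phi m) (weyl jk v) = e (jk.2 * (m - jk.1)) * br (phi (m - jk.1)) v.
Proof.
case: jk => j k; rewrite /weyl comp_lfunE /shiftU sum_lfunE braket_sumr /=.
rewrite (@big_only1 _ _ _ _ (m - j)) //; last first.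
  move=> n nm _; rewrite ketbraE braketZr braket_phi.
  by rewrite -subr_eq eq_sym (negPf nm) mulr0.
rewrite ketbraE braketZr subrK braket_phi eqxx mulr1 /clockV sum_lfunE braket_sumr.
rewrite (@big_only1 _ _ _ _ (m - j)) //; last first.
  move=> n nm _; rewrite scale_lfunE ketbraE !braketZr braket_phi.
  by rewrite eq_sym (negPf nm) !mulr0.
by rewrite scale_lfunE ketbraE !braketZr braket_phi eqxx mulr1 Zp_charM_nat.
Qed.

Lemma phase_space_ketbra u jk :
  phase_space_obs dot phi (ketbra dot u u) jk
  = d%:R^-1 *: ketbra dot (weyl jk u) (weyl jk u).
Proof.
rewrite /phase_space_obs div1r !comp_ketbra !(ketbra_comp_adjoint _ _ _ hphi).
by rewrite /weyl comp_lfunE.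
Qed.

Lemma weyl_phi0 jk : weyl jk (phi 0) = phi jk.1.
Proof.
apply: (orthonormal_basis_ext hphi) => m; rewrite braket_phi_weyl !braket_phi subr_eq0.
by case: eqP => [->|]; rewrite ?mulr0 // subrr mulr0 Zp_char0 mulr1.
Qed.

Lemma weyl_psi0 jk : weyl jk (psi phi 0) = e (- (jk.1 * jk.2)) *: psi phi jk.2.
Proof.
apply: (orthonormal_basis_ext hphi) => m; rewrite braket_phi_weyl braketZr.
rewrite !braket_phi_psi mulr0 Zp_char0 mulr1 mulrC [RHS]mulrCA -Zp_charD //.
congr (_ * e _); ring.
Qed.

Lemma noise_coef (t : R) :
  ((1 - t) * (1 / d%:R))%:C = (1 - t%:C) * d%:R^-1 :> R[i].
Proof.
by rewrite div1r rmorphM rmorphB rmorph1 /= fmorphV rmorph_nat.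
Qed.

Lemma obsA_elem (lambda : R) j m n :
  br (phi m) (obsA dot phi lambda j (phi n))
  = lambda%:C * ((m == j)%:R * (n == j)%:R) + (1 - lambda%:C) * d%:R^-1 * (m == n)%:R.
Proof. by rewrite /obsA braket_noisy_ketbra noise_coef !braket_phi (eq_sym j). Qed.

Lemma obsB_elem (gamma : R) k m n :
  br (phi m) (obsB dot phi gamma k (phi n))
  = gamma%:C * d%:R^-1 * e ((m - n) * k) + (1 - gamma%:C) * d%:R^-1 * (m == n)%:R.
Proof.
rewrite /obsB braket_noisy_ketbra noise_coef braket_phi braket_phi_psi braket_psi_phi.
by rewrite mulrACA -Zp_charD // overlap_sqr -mulrBl mulrA.
Qed.

Lemma obsB_psi (gamma : R) k :
  br (psi phi k) (obsB dot phi gamma k (psi phi k))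
  = gamma%:C + (1 - gamma%:C) * d%:R^-1.
Proof. by rewrite /obsB braket_noisy_ketbra noise_coef psi_unit !mulr1. Qed.

Lemma basis_trace_id : tr \1%VF = d%:R.
Proof.
rewrite /basis_trace; under eq_bigr do rewrite id_lfunE braket_phi eqxx.
by rewrite sumr_const card_ord Zp_cast.
Qed.

Lemma basis_trace_sum (I : finType) (F : I -> 'End(H)) :
  tr (\sum_i F i) = \sum_i tr (F i).
Proof.
rewrite /basis_trace exchange_big; apply: eq_bigr => i _.
by rewrite sum_lfunE braket_sumr.
Qed.

(** This vector is W_jk psi_0. Its phase makes the inner product with phi_j equal to the positive
    number s, as [ler_basis_trace_superposition] requires, and does not affect expectation
    values. *)
Definition phased_psi (jk : 'Z_d * 'Z_d) : H :=
  e (- (jk.1 * jk.2)) *: psi phi jk.2.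

Lemma phased_psi_braket jk (F : 'End(H)) :
  br (phased_psi jk) (F (phased_psi jk)) = br (psi phi jk.2) (F (psi phi jk.2)).
Proof.
rewrite /phased_psi lfunZ braketZl braketZr mulrA -Zp_charN // -Zp_charD //.
by rewrite addNr Zp_char0 mul1r.
Qed.

Lemma phased_psi_unit jk : br (phased_psi jk) (phased_psi jk) = 1.
Proof. by have := phased_psi_braket jk \1%VF; rewrite !id_lfunE psi_unit. Qed.

Lemma braket_phi_phased_psi jk : br (phi jk.1) (phased_psi jk) = s.
Proof.
rewrite /phased_psi braketZr braket_phi_psi mulrCA -Zp_charD //.
by rewrite addNr Zp_char0 mulr1.
Qed.

(** * Joint observables tested against the Weyl orbit of a superposition *)

Section Superposition.
Context (a b : R[i]).
Hypothesis a0 : 0 <= a.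
Hypothesis b0 : 0 <= b.
(** This is <x|x> = 1, because <phi_0|psi_0> = s. *)
Hypothesis ab1 : a ^+ 2 + b ^+ 2 + 2 * a * b * s = 1.
Let x := a *: phi 0 + b *: psi phi 0.

Let aR : Num.conj a = a. Proof. exact/CrealP/ger0_real. Qed.
Let bR : Num.conj b = b. Proof. exact/CrealP/ger0_real. Qed.

Lemma weyl_superposition jk : weyl jk x = a *: phi jk.1 + b *: phased_psi jk.
Proof. by rewrite lfunD !(lfunZ _ a, lfunZ _ b) weyl_phi0 weyl_psi0. Qed.

Lemma weyl_superposition_unit jk : br (weyl jk x) (weyl jk x) = 1.
Proof.
have vu : br (phased_psi jk) (phi jk.1) = s.
  by rewrite braketC braket_phi_phased_psi conj_overlap.
rewrite weyl_superposition !braketDl !braketDr.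
rewrite !(braketZl _ a, braketZl _ b) !(braketZr _ a, braketZr _ b) aR bR.
rewrite braket_phi eqxx mulr1n phased_psi_unit vu braket_phi_phased_psi -[RHS]ab1; ring.
Qed.

Lemma weyl_superposition_elem jk m :
  br (phi m) (weyl jk x) = e (jk.2 * (m - jk.1)) * (a * (m == jk.1)%:R + b * s).
Proof.
rewrite braket_phi_weyl braketDr (braketZr _ a) (braketZr _ b).
rewrite braket_phi braket_phi_psi mulr0 Zp_char0.
by rewrite subr_eq0 mulr1.
Qed.

Lemma ketbra_weyl_elem jk m n :
  br (phi m) (ketbra dot (weyl jk x) (weyl jk x) (phi n))
  = (a * (m == jk.1)%:R + b * s) * (a * (n == jk.1)%:R + b * s)
    * e ((m - n) * jk.2).
Proof.
rewrite ketbraE braketZr (braketC _ _ (phi n)) !weyl_superposition_elem !rmorphM /=.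
rewrite -Zp_charN // rmorphD !rmorphM /= aR bR conj_overlap rmorph_nat.
rewrite mulrACA mulrC -Zp_charD // [X in X * _]mulrC.
congr (_ * e _); ring.
Qed.

(** [ler_basis_trace_superposition] with u = phi_j and v = W_jk psi_0, summed over (j,k). The
    marginal conditions evaluate the sums of the two expectation values, and the traces add up to
    d. *)
Lemma joint_observable_gap (lambda gamma : R) C :
  joint_observable dot (obsA dot phi lambda) (obsB dot phi gamma) C ->
  \sum_jk s * (tr (C jk) - br (weyl jk x) (C jk (weyl jk x))) <=
  d%:R * ((a + b * s) * (a * s + b)
    - a * (a * s + b) * (lambda%:C + (1 - lambda%:C) * d%:R^-1)
    - b * (a + b * s) * (gamma%:C + (1 - gamma%:C) * d%:R^-1)).
Proof.
move=> [[C0 C1] CA CB].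
pose D jk := (a + b * s) * (a * s + b) * tr (C jk)
  - a * (a * s + b) * br (phi jk.1) (C jk (phi jk.1))
  - b * (a + b * s) * br (psi phi jk.2) (C jk (psi phi jk.2)).
rewrite [leRHS](_ : _ = \sum_jk D jk); last first.
  rewrite /D !big_split /= !sumrN -!mulr_sumr -basis_trace_sum C1 basis_trace_id.
  have -> : \sum_jk br (phi jk.1) (C jk (phi jk.1))
      = d%:R * (lambda%:C + (1 - lambda%:C) * d%:R^-1).
    transitivity (\sum_j \sum_k br (phi j) (C (j, k) (phi j))).
      by rewrite pair_bigA; apply: eq_bigr => -[].
    under eq_bigr => j _.
      rewrite -braket_sumr -sum_lfunE CA obsA_elem !eqxx !mulr1.
      over.
    by rewrite sumr_const card_ord Zp_cast // -[LHS]mulr_natl.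
  have -> : \sum_jk br (psi phi jk.2) (C jk (psi phi jk.2))
      = d%:R * (gamma%:C + (1 - gamma%:C) * d%:R^-1).
    transitivity (\sum_j \sum_k br (psi phi k) (C (j, k) (psi phi k))).
      by rewrite pair_bigA; apply: eq_bigr => -[].
    rewrite exchange_big /=; under eq_bigr => k _.
      rewrite -braket_sumr -sum_lfunE CB obsB_psi.
      over.
    by rewrite sumr_const card_ord Zp_cast // -[LHS]mulr_natl.
  ring.
apply: ler_sum => jk _; rewrite /D -phased_psi_braket.
have := ler_basis_trace_superposition hphi (C0 jk) _ (phased_psi_unit jk)
  (braket_phi_phased_psi jk) (ltW overlap_gt0) a0 b0.
rewrite /= -weyl_superposition weyl_superposition_unit mul1r; apply.
by rewrite braket_phi eqxx.
Qed.

Lemma joint_observable_gap_ge0 (lambda gamma : R) C jk :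
  joint_observable dot (obsA dot phi lambda) (obsB dot phi gamma) C ->
  0 <= s * (tr (C jk) - br (weyl jk x) (C jk (weyl jk x))).
Proof.
move=> [[C0 _] _ _]; rewrite mulr_ge0 ?(ltW overlap_gt0) // subr_ge0.
have := ler_basis_trace hphi (weyl jk x) (C0 jk).
by rewrite weyl_superposition_unit mul1r.
Qed.

Lemma joint_observable_bound (lambda gamma : R) C :
  joint_observable dot (obsA dot phi lambda) (obsB dot phi gamma) C ->
  a * (a * s + b) * (lambda%:C + (1 - lambda%:C) * d%:R^-1)
  + b * (a + b * s) * (gamma%:C + (1 - gamma%:C) * d%:R^-1)
  <= (a + b * s) * (a * s + b).
Proof.
move=> hC; have d0 : 0 < d%:R :> R[i] by rewrite ltr0n (ltnW hd).
have := le_trans (sumr_ge0 _ (fun jk _ => joint_observable_gap_ge0 jk hC))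
  (joint_observable_gap hC).
by rewrite pmulr_rge0 // -addrA -opprD subr_ge0.
Qed.

(** The nonnegative gaps then have a sum at most 0, so each vanishes and [basis_trace_rank1]
    applies. *)
Lemma joint_observable_rank1 (lambda gamma : R) C jk :
  joint_observable dot (obsA dot phi lambda) (obsB dot phi gamma) C ->
  a * (a * s + b) * (lambda%:C + (1 - lambda%:C) * d%:R^-1)
  + b * (a + b * s) * (gamma%:C + (1 - gamma%:C) * d%:R^-1)
  = (a + b * s) * (a * s + b) ->
  C jk = tr (C jk) *: ketbra dot (weyl jk x) (weyl jk x).
Proof.
move=> hC eq_mu; have := joint_observable_gap hC.
rewrite -addrA -opprD eq_mu subrr mulr0 => le0.
have ge0 i : true -> _ := fun _ => joint_observable_gap_ge0 i hC.
have /eqP := le_anti (introT andP (conj le0 (sumr_ge0 _ ge0))).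
rewrite psumr_eq0 // => /allP /(_ jk (mem_index_enum jk)) /=.
rewrite mulf_eq0 gt_eqF ?overlap_gt0 //= subr_eq0 => /eqP.
by apply: basis_trace_rank1; [| case: hC => -[] | apply: weyl_superposition_unit].
Qed.

Lemma sum_eq_indicator (m n : 'Z_d) :
  \sum_j (m == j)%:R * (n == j)%:R = (m == n)%:R :> R[i].
Proof.
rewrite (@big_only1 _ _ _ _ m) // ?eqxx ?mul1r ?[n == m]eq_sym // => j jm _.
by rewrite eq_sym (negPf jm) mul0r.
Qed.

Let onemb2 : 1 - b ^+ 2 = a ^+ 2 + 2 * a * b * s.
Proof. by rewrite -{1}ab1; ring. Qed.

Let onema2 : 1 - a ^+ 2 = b ^+ 2 + 2 * a * b * s.
Proof. by rewrite -{1}ab1; ring. Qed.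

(** Entrywise form of the first marginal of C_T: the factor for m = n is what the character sum over
    k leaves. *)
Lemma superposition_marginal_row (j m n : 'Z_d) :
  (a * (m == j)%:R + b * s) * (a * (n == j)%:R + b * s) * (m == n)%:R
  = (1 - b ^+ 2) * ((m == j)%:R * (n == j)%:R) + b ^+ 2 * d%:R^-1 * (m == n)%:R.
Proof.
rewrite onemb2 -overlap_sqr; have [->|mn] := eqVneq m n.
  by case: (n == j) => /=; ring.
have -> : (m == j)%:R * (n == j)%:R = 0 :> R[i].
  by case: eqP => [<-|]; rewrite ?mul0r // eq_sym (negPf mn) mulr0.
by rewrite !mulr0 addr0.
Qed.

(** Used for the second marginal of C_T, where the phase e((m - n) k) does not depend on j and
    factors out. *)
Lemma superposition_marginal_col (m n : 'Z_d) :
  \sum_j (a * (m == j)%:R + b * s) * (a * (n == j)%:R + b * s)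
  = 1 - a ^+ 2 + a ^+ 2 * (m == n)%:R.
Proof.
have sum1 (l : 'Z_d) : \sum_j (l == j)%:R = 1 :> R[i].
  rewrite (@big_only1 _ _ _ _ l) ?eqxx // => j jl _.
  by rewrite eq_sym (negPf jl).
transitivity (\sum_j (a ^+ 2 * ((m == j)%:R * (n == j)%:R)
    + a * b * s * (m == j)%:R + a * b * s * (n == j)%:R + b ^+ 2 * d%:R^-1)).
  by apply: eq_bigr => j _; rewrite -overlap_sqr; ring.
rewrite !big_split /= -!mulr_sumr !sum1.
rewrite -overlap_sqr sum_overlap_sqr sum_eq_indicator.
rewrite onema2; ring.
Qed.

Lemma obsA_sum (lambda : R) : \sum_j obsA dot phi lambda j = \1%VF.
Proof.
apply: (op_basis_ext hphi) => m n; rewrite sum_lfunE braket_sumr id_lfunE braket_phi.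
under eq_bigr do rewrite obsA_elem.
rewrite big_split /= -mulr_sumr sumr_const card_ord [X in _ *+ X]Zp_cast //.
rewrite sum_eq_indicator.
rewrite -[X in _ + X]mulr_natl mulrA [d%:R * _]mulrCA mulfV ?natrC_neq0 //.
ring.
Qed.

Lemma phase_space_elem jk m n :
  br (phi m) (phase_space_obs dot phi (ketbra dot x x) jk (phi n))
  = d%:R^-1 * ((a * (m == jk.1)%:R + b * s) * (a * (n == jk.1)%:R + b * s)
    * e ((m - n) * jk.2)).
Proof.
by rewrite phase_space_ketbra scale_lfunE braketZr ketbra_weyl_elem.
Qed.

Lemma phase_space_joint (lambda gamma : R) :
  lambda%:C = 1 - b ^+ 2 -> gamma%:C = 1 - a ^+ 2 ->
  joint_observable dot (obsA dot phi lambda) (obsB dot phi gamma)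
    (phase_space_obs dot phi (ketbra dot x x)).
Proof.
move=> lamE gamE.
have rowE j :
    \sum_k phase_space_obs dot phi (ketbra dot x x) (j, k) = obsA dot phi lambda j.
  apply: (op_basis_ext hphi) => m n; rewrite sum_lfunE braket_sumr obsA_elem lamE.
  under eq_bigr do rewrite phase_space_elem /=.
  rewrite -!mulr_sumr Zp_char_sum // subr_eq0 subKr.
  rewrite -superposition_marginal_row.
  by rewrite mulrCA mulKf ?natrC_neq0.
split => //.
- split=> [jk u|].
    rewrite phase_space_ketbra scale_lfunE braketZr mulr_ge0 ?invr_ge0 ?ler0n //.
    exact: ketbra_positive.
  rewrite -(obsA_sum lambda); under [RHS]eq_bigr do rewrite -rowE.
  by rewrite pair_bigA; apply: eq_bigr => -[].
- move=> k; apply: (op_basis_ext hphi) => m n; rewrite sum_lfunE braket_sumr.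
  rewrite obsB_elem gamE; under eq_bigr do rewrite phase_space_elem /=.
  rewrite -mulr_sumr -mulr_suml superposition_marginal_col.
  have [->|mn] := eqVneq m n; last by rewrite /=; ring.
  by rewrite subrr mul0r Zp_char0 /=; ring.
Qed.

(** Equality in the bound leaves only the traces c_jk of C(j,k) to be found. The (j + y, j) entry of
    the first marginal gives the Fourier coefficient of c_j at y after division by a factor that is
    nonzero when b s > 0; the case b = 0 uses the second marginal instead. *)
Lemma joint_observable_unique (lambda gamma : R) C jk :
  lambda%:C = 1 - b ^+ 2 -> gamma%:C = 1 - a ^+ 2 ->
  joint_observable dot (obsA dot phi lambda) (obsB dot phi gamma) C ->
  C jk = phase_space_obs dot phi (ketbra dot x x) jk.
Proof.
move=> lamE gamE hC.
have C1 jk' : C jk' = tr (C jk') *: ketbra dot (weyl jk' x) (weyl jk' x).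
  apply: (joint_observable_rank1 jk' hC); rewrite lamE gamE !subKr -overlap_sqr.
  (* So lambda + (1 - lambda)/d and gamma + (1 - gamma)/d are the squares of a + b s and a s + b,
     and the required equality reduces to <x|x> = 1. *)
  have eA : 1 - b ^+ 2 + b ^+ 2 * (s * s) = (a + b * s) ^+ 2 by rewrite onemb2; ring.
  have eB : 1 - a ^+ 2 + a ^+ 2 * (s * s) = (a * s + b) ^+ 2 by rewrite onema2; ring.
  rewrite eA eB; transitivity ((a + b * s) * (a * s + b)
    * (a ^+ 2 + b ^+ 2 + 2 * a * b * s)); first by ring.
  by rewrite ab1 mulr1.
rewrite phase_space_ketbra C1; congr (_ *: _).
have Cel jk' m n : br (phi m) (C jk' (phi n)) = tr (C jk') *
    ((a * (m == jk'.1)%:R + b * s) * (a * (n == jk'.1)%:R + b * s)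
    * e ((m - n) * jk'.2)).
  by rewrite {1}C1 scale_lfunE braketZr ketbra_weyl_elem.
case: hC => _ CA CB; case: jk => j k.
(* For b = 0 one has a^2 = 1 and gamma = 0. Only C(j,k) contributes to the (j,j) entry of the second
   marginal at k, which is 1/d. *)
have [b_0|bn0] := eqVneq b 0.
  have a2 : a ^+ 2 = 1 by rewrite -[RHS]ab1 b_0; ring.
  have := congr1 (fun F : 'End(H) => br (phi j) (F (phi j))) (CB k).
  rewrite sum_lfunE braket_sumr (@big_only1 _ _ _ _ j) //; last first.
    by move=> i ij _; rewrite Cel /= eq_sym (negPf ij) b_0 /=; ring.
  rewrite Cel obsB_elem gamE a2 eqxx b_0 [j - j]subrr [0 * k]mul0r Zp_char0 /= => h.
  transitivity (tr (C (j, k)) * a ^+ 2); first by rewrite a2 mulr1.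
  transitivity (tr (C (j, k)) * ((a * 1 + 0 * s) * (a * 1 + 0 * s) * 1)).
    by ring.
  by rewrite h; ring.
have bs_gt0 : 0 < b * s by rewrite mulr_gt0 ?overlap_gt0 // lt_def bn0.
have fourier y : \sum_k' tr (C (j, k')) * e (k' * y) = (y == 0)%:R.
  have := congr1 (fun F : 'End(H) => br (phi (j + y)) (F (phi j))) (CA j).
  rewrite sum_lfunE braket_sumr obsA_elem lamE subKr -superposition_marginal_row.
  set X := _ * (a * (j == j)%:R + b * s).
  have X0 : X != 0 by rewrite mulf_neq0 // gt_eqF // ltr_wpDl // mulr_ge0 ?ler0n.
  under eq_bigr => k' _.
    rewrite Cel /= -/X [j + y]addrC addrK mulrCA [y * k']mulrC.
    over.
  rewrite -mulr_sumr => /(mulfI X0) ->.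
  by rewrite -subr_eq0 addrAC subrr add0r.
apply: (mulfI natrC_neq0); rewrite mulfV ?natrC_neq0 //.
(* Fourier inversion: the inner sum over y is d at k' = k and 0 elsewhere. *)
transitivity (\sum_k' tr (C (j, k')) * \sum_y e ((k' - k) * y)).
  rewrite (@big_only1 _ _ _ _ k) // => [|k' kk _]; rewrite Zp_char_sum // subr_eq0.
    by rewrite eqxx mulr1 mulrC.
  by rewrite (negPf kk) !mulr0.
transitivity (\sum_y e (- (k * y)) * \sum_k' tr (C (j, k')) * e (k' * y)).
  under eq_bigr do rewrite mulr_sumr.
  rewrite exchange_big; apply: eq_bigr => y _; rewrite mulr_sumr.
  apply: eq_bigr => k' _; rewrite mulrCA -Zp_charD // [- _ + _]addrC.
  by rewrite mulrBl.
rewrite (@big_only1 _ _ _ _ 0) // => [|y y0 _]; rewrite fourier.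
  by rewrite eqxx mulr1 mulr0 oppr0 Zp_char0.
by rewrite (negPf y0) mulr0.
Qed.

End Superposition.

(** With a = 1 and b = 0 the bound is an equality for every gamma, so C(j,k) is a multiple of
    |phi_j><phi_j|. The second marginal is then diagonal in [phi], while its (0,1) entry at k = 0 is
    gamma/d. *)
Lemma joint_observable_sharp (gamma : R) C :
  joint_observable dot (obsA dot phi 1) (obsB dot phi gamma) C -> gamma = 0.
Proof.
move=> hC; have ab1 : 1 ^+ 2 + 0 ^+ 2 + 2 * 1 * 0 * s = 1 :> R[i] by ring.
have C1 jk := joint_observable_rank1 ler01 (lexx 0) ab1 jk hC.
case: hC => _ _ CB.
have := congr1 (fun F : 'End(H) => br (phi 0) (F (phi 1))) (CB 0).
rewrite sum_lfunE braket_sumr big1 => [|j _].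
  rewrite obsB_elem [0 == 1]eq_sym oner_eq0 [_ * 0]mulr0 Zp_char0.
  rewrite mulr1 mulr0n mulr0 addr0.
  by move/esym/eqP; rewrite mulf_eq0 invr_eq0 (negPf natrC_neq0) orbF => /eqP[].
rewrite C1; last by ring.
rewrite scale_lfunE braketZr (ketbra_weyl_elem ler01 (lexx 0)) /=.
have -> : (0 == j) = (0 == j) && (1 != j).
  by case: eqP => // <-; rewrite oner_eq0.
by case: (0 == j); case: (1 == j) => /=; ring.
Qed.

(** The map (j,k) to E(j)/d has first marginal E and uniform second marginal. Mixing it in with
    weight 1 - t preserves E and only adds white noise to the other marginal. *)
Lemma joint_observable_mix (E : 'Z_d -> 'End(H)) (gamma t : R) C :
  0 <= t <= 1 -> joint_observable dot E (obsB dot phi gamma) C ->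
  joint_observable dot E (obsB dot phi (t * gamma))
    (fun jk => t%:C *: C jk + ((1 - t) * (1 / d%:R))%:C *: E jk.1).
Proof.
move=> /andP[t0 t1] [[C0 C1] CE CB].
have E1 : \sum_j E j = \1%VF.
  rewrite -C1; under eq_bigr do rewrite -CE.
  by rewrite pair_bigA; apply: eq_bigr => -[].
have E0 j : positive_op dot (E j).
  by move=> u; rewrite -CE sum_lfunE braket_sumr; apply: sumr_ge0 => k _; apply: C0.
have rowE j : \sum_k (t%:C *: C (j, k) + ((1 - t) * (1 / d%:R))%:C *: E j) = E j.
  rewrite big_split /= -scaler_sumr CE sumr_const card_ord [X in _ *+ X]Zp_cast //.
  rewrite -scaler_nat scalerA -scalerDl noise_coef mulrCA mulfV ?natrC_neq0 //.
  by rewrite mulr1 addrC subrK scale1r.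
split=> //.
- split=> [jk u|].
    rewrite add_lfunE !scale_lfunE braketDr !braketZr noise_coef.
    apply: addr_ge0; apply: mulr_ge0; rewrite ?ler0c //.
    - exact: C0.
    - by rewrite mulr_ge0 ?invr_ge0 ?ler0n // subr_ge0 -[1]/(1%:C) lecR.
    - exact: E0.
  rewrite -E1; under [RHS]eq_bigr do rewrite -rowE.
  by rewrite pair_bigA; apply: eq_bigr => -[].
- move=> k; rewrite big_split /= -!scaler_sumr CB E1 /obsB scalerDr !scalerA -addrA.
  rewrite -scalerDl !noise_coef rmorphM; congr (_ + _ *: _).
  by rewrite /=; ring.
Qed.

(** Lets [weyl_superposition_unit] be applied to [chi] itself, which yields trace one. *)
Lemma superposition_fixed (a b : R[i]) :
  weyl (0, 0) (a *: phi 0 + b *: psi phi 0) = a *: phi 0 + b *: psi phi 0.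
Proof.
rewrite weyl_superposition /phased_psi /= mulr0 oppr0 Zp_char0 scale1r //.
Qed.

End Weyl.

(** * Real identities for [alpha], [beta] and [gamma_bound] *)

Section GammaMax.
Context (R : realType) (d : nat).
Hypothesis hd : (1 < d)%N.
Implicit Types lambda gamma : R.

Let natr_ge2 : 2 <= d%:R :> R.
Proof. by rewrite ler_nat. Qed.

(** The radicand in [gamma_bound] factors as ((d - 1) lambda + 1)(1 - lambda), so its root is the
    cross term in the square of [alpha]. *)
Lemma alphaE lambda : 0 <= lambda <= 1 ->
  alpha d lambda ^+ 2 = 1 - gamma_bound d lambda.
Proof.
have d2 := natr_ge2; move=> /andP[l0 l1]; rewrite /alpha /gamma_bound.
have -> : (1 - d%:R) * lambda ^+ 2 + (d%:R - 2) * lambda + 1 =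
   ((d%:R - 1) * lambda + 1) * (1 - lambda) by ring.
have P0 : 0 <= (d%:R - 1) * lambda + 1 by nra.
have B0 : 0 <= 1 - lambda by lra.
rewrite sqrtrM //.
have D2 : Num.sqrt d%:R ^+ 2 = d%:R :> R by rewrite sqr_sqrtr ?ler0n.
have P2 := sqr_sqrtr P0; have B2 := sqr_sqrtr B0.
rewrite exprMn expr_div_n D2 expr1n sqrrB P2 B2.
by field; rewrite gt_eqF //; lra.
Qed.

Lemma betaE lambda : lambda <= 1 -> beta lambda ^+ 2 = 1 - lambda.
Proof. by move=> l1; rewrite sqr_sqrtr // subr_ge0. Qed.

Lemma alpha_ge0 lambda : 0 <= lambda -> 0 <= alpha d lambda.
Proof.
have d2 := natr_ge2; move=> l0.
rewrite mulr_ge0 ?divr_ge0 ?sqrtr_ge0 // subr_ge0 ler_wsqrtr //.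
nra.
Qed.

Lemma alpha_beta_norm lambda : 0 <= lambda <= 1 ->
  alpha d lambda ^+ 2 + beta lambda ^+ 2
  + 2 * alpha d lambda * beta lambda * (1 / Num.sqrt d%:R) = 1.
Proof.
have d2 := natr_ge2; move=> /andP[l0 l1]; rewrite /alpha /beta.
have P0 : 0 <= (d%:R - 1) * lambda + 1 by nra.
have B0 : 0 <= 1 - lambda by lra.
have D2 : Num.sqrt d%:R ^+ 2 = d%:R :> R by rewrite sqr_sqrtr ?ler0n.
have D0 : Num.sqrt d%:R != 0 :> R by rewrite gt_eqF // sqrtr_gt0; lra.
have P2 := sqr_sqrtr P0; have B2 := sqr_sqrtr B0.
set P := Num.sqrt _ in P2 *; set B := Num.sqrt _ in B2 *.
set D := Num.sqrt _ in D2 D0 *.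
(* The mixed products P B cancel, and (P^2 - B^2)/d = lambda. *)
have -> : (1 / D * (P - B)) ^+ 2 + B ^+ 2 + 2 * (1 / D * (P - B)) * B * (1 / D)
  = (P ^+ 2 - B ^+ 2) / D ^+ 2 + B ^+ 2 by field.
by rewrite P2 B2 D2; field; rewrite gt_eqF //; lra.
Qed.

Lemma gamma_bound_itv lambda : 0 <= lambda <= 1 -> 0 <= gamma_bound d lambda <= 1.
Proof.
have d2 := natr_ge2; move=> l01; apply/andP; split; last first.
  by rewrite -subr_ge0 -alphaE // sqr_ge0.
rewrite mulr_ge0 ?divr_ge0 ?ler0n // addr_ge0 ?mulr_ge0 ?sqrtr_ge0 //; lra.
Qed.

(* Up to the factor [d], squaring turns [gamma <= gamma_bound d lambda] into the
   symmetric condition [S <= 0]. *)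
Lemma gamma_bound_sym lambda gamma : 0 <= lambda <= 1 -> 0 <= gamma <= 1 ->
  gamma <= gamma_bound d lambda -> lambda <= gamma_bound d gamma.
Proof.
move=> /andP[l0 l1] /andP[g0 g1].
have d2 := natr_ge2; have d0 : 0 < d%:R :> R by lra.
rewrite /gamma_bound div1r !ler_pdivlMl // -!lerBlDl.
have Q0 t : 0 <= t -> t <= 1 -> 0 <= (1 - d%:R) * t ^+ 2 + (d%:R - 2) * t + 1 :> R.
  move=> t0 t1; have -> : (1 - d%:R) * t ^+ 2 + (d%:R - 2) * t + 1 =
    ((d%:R - 1) * t + 1) * (1 - t) :> R by ring.
  by apply: mulr_ge0; nra.
have le2sqrt (X Q : R) : 0 <= Q ->
    (X <= 2 * Num.sqrt Q) = (X <= 0) || (X ^+ 2 <= 4 * Q).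
  move=> hQ; have -> : 2 * Num.sqrt Q = Num.sqrt (4 * Q).
    by rewrite sqrtrM // (_ : 4 = 2 ^+ 2) ?sqrtr_sqr ?ger0_norm //; ring.
  have [X0|X0] /= := leP X 0; first by rewrite (le_trans X0) ?sqrtr_ge0.
  by rewrite -[leLHS](ger0_norm (ltW X0)) -sqrtr_sqr ler_sqrt // mulr_ge0.
rewrite !le2sqrt ?Q0 //.
set n : R := d%:R in d2 d0 *.
pose S := n * gamma ^+ 2 + n * lambda ^+ 2 - 2 * (n - 2) * (gamma + lambda)
  + 2 * (n - 2) * gamma * lambda + n - 4.
set X := n * gamma - _; set Y := n * lambda - _.
have -> : (X ^+ 2 <= 4 * ((1 - n) * lambda ^+ 2 + (n - 2) * lambda + 1)) = (S <= 0).
  rewrite -subr_le0 -(pmulr_rle0 S d0); congr (_ <= _).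
  by rewrite /X /S; ring.
have -> : (Y ^+ 2 <= 4 * ((1 - n) * gamma ^+ 2 + (n - 2) * gamma + 1)) = (S <= 0).
  rewrite -subr_le0 -(pmulr_rle0 S d0); congr (_ <= _).
  by rewrite /Y /S; ring.
case/orP=> [X0|->]; last by rewrite orbT.
(* With X <= 0 squaring gives no information, and Y <= 0 is immediate. If Y > 0, the two sign
   conditions, multiplied by p and gamma, give [h1] and [h2]; these add up to S <= -2 p. *)
have [//|Y0] := leP Y 0; rewrite /=.
set p := 1 - lambda.
have -> : S = n * p ^+ 2 - 4 * p - 2 * (n - 2) * p * gamma + n * gamma ^+ 2.
  by rewrite /S /p; ring.
have p0 : 0 <= p by rewrite subr_ge0.
have h1 : p * (n * p) <= p * (2 + (n - 2) * gamma).
  by apply: ler_wpM2l => //; rewrite /p; move: Y0; rewrite /Y; lra.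
have h2 : gamma * (n * gamma) <= gamma * ((n - 2) * p).
  by apply: ler_wpM2l => //; rewrite /p; move: X0; rewrite /X; lra.
lra.
Qed.

End GammaMax.

(** * The threshold for a fixed lambda *)

Section Threshold.
Context (R : realType) (H : vectType R[i]) (dot : {dot H for Num.conj}).
Context (d : nat) (phi : 'Z_d -> H).
Hypothesis hd : (1 < d)%N.
Hypothesis hphi : orthonormal_basis dot phi.
Local Notation s := (overlap R d).
Context (lambda : R).
Hypothesis hlambda : 0 <= lambda <= 1.
Local Notation a := ((alpha d lambda)%:C).
Local Notation b := ((beta lambda)%:C).

Lemma alphaC_ge0 : 0 <= a.
Proof. by rewrite ler0c alpha_ge0 //; case/andP: hlambda. Qed.

Lemma betaC_ge0 : 0 <= b.
Proof. by rewrite ler0c sqrtr_ge0. Qed.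

Lemma alpha_beta_normC : a ^+ 2 + b ^+ 2 + 2 * a * b * s = 1.
Proof.
have := alpha_beta_norm hd hlambda; rewrite /overlap.
move: (alpha _ _) (beta _) (1 / _) => x y z /(congr1 (real_complex R)).
by rewrite !rmorphD !rmorphM rmorph1 rmorph_nat.
Qed.

Lemma lambdaC : lambda%:C = 1 - b ^+ 2.
Proof.
rewrite -rmorphXn /= betaE; last by case/andP: hlambda.
by rewrite rmorphB rmorph1 subKr.
Qed.

Lemma gamma_boundC : (gamma_bound d lambda)%:C = 1 - a ^+ 2.
Proof. by rewrite -rmorphXn /= alphaE // rmorphB rmorph1 subKr. Qed.

Lemma jmAB_le gamma : jmAB dot phi lambda gamma -> gamma <= gamma_bound d lambda.
Proof.
case=> C hC; have [l1|l1] := eqVneq lambda 1.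
  move: hC; rewrite l1 => /(joint_observable_sharp hd hphi) ->.
  by rewrite -l1; case/andP: (gamma_bound_itv hd hlambda).
have := joint_observable_bound hd hphi alphaC_ge0 betaC_ge0 alpha_beta_normC hC.
have b0 : 0 < b.
  rewrite ltcR sqrtr_gt0 subr_gt0 lt_neqAle l1; by case/andP: hlambda.
have s0 : 0 < s by apply: overlap_gt0.
have s1 : 0 < 1 - d%:R^-1 :> R[i].
  by rewrite subr_gt0 invf_lt1 ?ltr1n ?ltr0n ?(ltnW hd).
(* This is the coefficient of gamma in [joint_observable_bound]; it is positive because lambda < 1
   makes b > 0. *)
have c0 : 0 < b * (a + b * s) * (1 - d%:R^-1).
  by rewrite !mulr_gt0 // ltr_wpDl ?alphaC_ge0 // mulr_gt0.
rewrite -subr_ge0 lambdaC => ge0; rewrite -subr_ge0 -ler0c -(pmulr_rge0 _ c0).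
apply: le_trans ge0 _; rewrite le_eqVlt; apply/orP; left; apply/eqP.
rewrite rmorphB /= gamma_boundC -overlap_sqr //.
have := alpha_beta_normC; move: a b s (gamma%:C) => x y z g xy1.
apply/eqP; rewrite -subr_eq0; apply/eqP.
(* The gap in the bound and [c0] times gamma_max - gamma differ by a multiple of <x|x> - 1. *)
transitivity ((1 - z ^+ 2) * x * y * (x ^+ 2 + y ^+ 2 + 2 * x * y * z - 1)).
  by ring.
by rewrite xy1 subrr mulr0.
Qed.

Lemma jmAB_gamma_bound : jmAB dot phi lambda (gamma_bound d lambda).
Proof.
eexists; apply: (phase_space_joint hd hphi alphaC_ge0 betaC_ge0 alpha_beta_normC).
  exact: lambdaC.
exact: gamma_boundC.
Qed.

Lemma jmAB_iff gamma : 0 <= gamma ->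
  jmAB dot phi lambda gamma <-> gamma <= gamma_bound d lambda.
Proof.
move=> g0; split=> [|g1]; first exact: jmAB_le.
have [C hC] := jmAB_gamma_bound.
(* The mixing weight will be t = gamma / gamma_max, so a vanishing gamma_max is treated first. *)
have [gm0|gm0] := eqVneq (gamma_bound d lambda) 0.
  exists C; suff -> : gamma = gamma_bound d lambda by [].
  by apply/eqP; rewrite eq_le g1 gm0 g0.
have gm_gt0 : 0 < gamma_bound d lambda.
  by rewrite lt_def gm0; case/andP: (gamma_bound_itv hd hlambda).
rewrite -[gamma](divfK gm0); eexists; apply: joint_observable_mix hC => //.
by rewrite divr_ge0 ?(ltW gm_gt0) //= ler_pdivrMr // mul1r.
Qed.

End Threshold.

Theorem proposition5 (R : realType) (d : nat) (hd : (2 <= d)%N)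
    (H : vectType R[i]) (dot : {dot H for Num.conj})
    (hdim : \dim (fullv : {vspace H}) = d)
    (phi : 'Z_d -> H) (hphi : orthonormal_basis dot phi)
    (lambda gamma : R) (hlambda : 0 <= lambda <= 1) (hgamma : 0 <= gamma <= 1) :
  exists gamma_max : R,
    [/\ is_gamma_max dot phi lambda gamma_max,
        gamma_max = gamma_bound d lambda,
        jmAB dot phi lambda gamma <-> gamma <= gamma_max,
        jmAB dot phi lambda gamma <-> lambda <= gamma_bound d gamma
      & gamma = gamma_max ->
        let T := ketbra dot (chi phi lambda) (chi phi lambda) in
        [/\ is_state dot T,
            joint_observable dot (obsA dot phi lambda) (obsB dot phi gamma)
              (phase_space_obs dot phi T)
          & forall C : 'Z_d * 'Z_d -> 'End(H),
            joint_observable dot (obsA dot phi lambda) (obsB dot phi gamma) C ->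
            forall jk, C jk = phase_space_obs dot phi T jk]].
Proof.
have [g0 _] := andP hgamma; exists (gamma_bound d lambda); split=> //.
- split; [exact: gamma_bound_itv | exact: jmAB_gamma_bound |].
  by move=> g' _; apply: jmAB_le.
- exact: jmAB_iff.
- apply: (iff_trans (jmAB_iff hd hphi hlambda g0)).
  by split; apply: gamma_bound_sym.
move=> gE T.
have a0 := alphaC_ge0 hd hlambda; have b0 := betaC_ge0 lambda.
have ab1 := alpha_beta_normC hd hlambda; have lE := lambdaC hlambda.
have gC := gamma_boundC hd hlambda; rewrite -gE in gC.
split.
- split; first exact: ketbra_positive.
  rewrite trace_op_ketbra /chi -(superposition_fixed hd hphi).
  exact: weyl_superposition_unit.
- exact: phase_space_joint.
- by move=> C hC jk; apply: joint_observable_unique hC.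
Qed.
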